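(* Let $F_1=\{f_1,\dots,f_\mu\}$ and $F_2=\{f_{\mu+1},\dots,f_\nu\}$ be two ordered finite sets of mappings $f_k:\mathbb{R}^m\times\mathbb{R}^m\to\mathscr{I}^{p,q}$. The geometric Fourier transform $\mathcal{F}_{F_1,F_2}$ is left linear (respectively right linear) if $F_1$ (respectively $F_2$) consists only of functions $f_k$ with values in the center of $C\ell_{p,q}$, that is, $A f_k(x,u)=f_k(x,u)A$ for all $x,u\in\mathbb{R}^m$ and all $A\in C\ell_{p,q}$.
   Context: $C\ell_{p,q}$, $p+q=n\in\mathbb{N}$, is the real associative unital geometric (Clifford) algebra of dimension $2^n$ generated by $e_1,\dots,e_n$ with $e_je_k+e_ke_j=2\epsilon_j\delta_{jk}$, $\epsilon_j=1$ for $j\le p$, $\epsilon_j=-1$ for $j>p$. Its elements are called multivectors; a multivector field is a map $\mathbb{R}^m\to C\ell_{p,q}$. The exponential of a multivector is $e^{A}=\sum_{j\ge0}A^j/j!$. $\mathscr{I}^{p,q}=\{0\}\cup\{i\in C\ell_{p,q}: i^2 \text{ is a negative real number}\}$. GFT: for ordered finite sets $F_1=\{f_1,\dots,f_\mu\}$, $F_2=\{f_{\mu+1},\dots,f_\nu\}$ of mappings $f_k:\mathbb{R}^m\times\mathbb{R}^m\to\mathscr{I}^{p,q}$, $$\mathcal{F}_{F_1,F_2}(A)(u)=\int_{\mathbb{R}^m}\prod_{f\in F_1}e^{-f(x,u)}\,A(x)\prod_{f\in F_2}e^{-f(x,u)}\,d^mx,$$ with products taken from left to right in increasing order of the index (empty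 product $=1$). All multivector fields are assumed to be such that the integrals defining the transforms involved exist. Left linear means linear with respect to constant multivector factors from the left: for all $C,D\in C\ell_{p,q}$, all multivector fields $B,E$ and all $u\in\mathbb{R}^m$, $\mathcal{F}_{F_1,F_2}(CB+DE)(u)=C\,\mathcal{F}_{F_1,F_2}(B)(u)+D\,\mathcal{F}_{F_1,F_2}(E)(u)$. Right linear means $\mathcal{F}_{F_1,F_2}(BC+ED)(u)=\mathcal{F}_{F_1,F_2}(B)(u)\,C+\mathcal{F}_{F_1,F_2}(E)(u)\,D$. *)

(* Defs.v *)
From HB Require Import structures.
From mathcomp Require Import all_boot all_order all_algebra.
From mathcomp Require Import all_classical all_reals all_analysis.

Set Implicit Arguments.
Unset Strict Implicit.
Unset Printing Implicit Defensive.

Import Order.TTheory GRing.Theory Num.Theory.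
Import numFieldNormedType.Exports.

Local Open Scope ring_scope.

Section SymDiff.
Variable T : finType.
Implicit Types I J K : {set T}.

Definition symdiff I J : {set T} := (I :\: J) :|: (J :\: I).

Lemma in_symdiff I J x : (x \in symdiff I J) = (x \in I) (+) (x \in J).
Proof. by rewrite !inE; case: (x \in I); case: (x \in J). Qed.

Lemma symdiffC I J : symdiff I J = symdiff J I.
Proof. by apply/setP=> x; rewrite !in_symdiff addbC. Qed.

Lemma symdiffA I J K : symdiff I (symdiff J K) = symdiff (symdiff I J) K.
Proof. by apply/setP=> x; rewrite !in_symdiff addbA. Qed.

Lemma symdiffK I J : symdiff I (symdiff I J) = J.
Proof. by apply/setP=> x; rewrite !in_symdiff addKb. Qed.

Lemma symdiff0 I : symdiff finset.set0 I = I.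
Proof. by apply/setP=> x; rewrite in_symdiff inE. Qed.

Lemma symdiffv I : symdiff I I = finset.set0.
Proof. by apply/setP=> x; rewrite in_symdiff inE addbb. Qed.

Lemma symdiff_eq I J K : (symdiff I J == K) = (J == symdiff I K).
Proof.
by apply/eqP/eqP => [<-|->]; rewrite symdiffK.
Qed.

End SymDiff.

(* A multivector is its family of coordinates on the blades
   e_I = e_(i_1) ... e_(i_k), for I = {i_1 < ... < i_k} a set of indices.
   Beware that {ffun _ -> R} itself carries the entrywise product. *)
Definition Cl (R : realType) (p q : nat) := {ffun {set 'I_(p + q)} -> R}.

HB.instance Definition _ (R : realType) (p q : nat) :=
  GRing.Zmodule.copy (Cl R p q) {ffun {set 'I_(p + q)} -> R}.

Section CliffordAlgebra.
Variables (R : realType) (p q : nat).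
Local Notation n := (p + q)%N.
Implicit Types (I J K : {set 'I_n}) (A B C : Cl R p q).

(* Indices start at 0, so e_0, ..., e_(p-1) are those with square 1. *)
Definition signature (k : 'I_n) : R := if (k < p)%N then 1 else -1.

(* e_I * e_J = blade_sign I J * e_(symdiff I J): one factor -1 for each
   transposition needed to sort the generators, then e_k ^+ 2 for each
   repeated generator. *)
Definition blade_sign I J : R :=
  (\prod_(i in I) \prod_(j in J | (j < i)%N) -1)
  * \prod_(k in I :&: J) signature k.

Definition Cl_one : Cl R p q := [ffun K => (K == finset.set0)%:R].

Definition Cl_mul A B : Cl R p q :=
  [ffun K => \sum_I \sum_(J | symdiff I J == K)
               blade_sign I J * (A I * B J)].

Lemma blade_signE I J : blade_sign I J =
  (\prod_i \prod_j (if [&& i \in I, j \in J & (j < i)%N] then -1 else 1))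
  * \prod_k (if (k \in I) && (k \in J) then signature k else 1).
Proof.
rewrite /blade_sign; congr (_ * _).
  rewrite big_mkcond; apply: eq_bigr => i _; case: ifP => iI.
    by rewrite big_mkcond.
  by rewrite big1.
by rewrite big_mkcond; apply: eq_bigr => k _; rewrite inE.
Qed.

Lemma blade_sign_cocycle I J K :
  blade_sign I J * blade_sign (symdiff I J) K
  = blade_sign I (symdiff J K) * blade_sign J K.
Proof.
rewrite !blade_signE mulrACA [RHS]mulrACA.
congr (_ * _).
  apply/eqP; rewrite -subr_eq0.
  pose G (X Y : {set 'I_n}) i j : R :=
    if [&& i \in X, j \in Y & (j < i)%N] then -1 else 1.
  pose S X Y := \prod_i \prod_j G X Y i j.
  have Sl X Y Z : S (symdiff X Y) Z = S X Z * S Y Z.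
    rewrite /S -big_split; apply: eq_bigr => i _ /=.
    rewrite -big_split; apply: eq_bigr => j _ /=.
    rewrite /G in_symdiff; case: (i \in X); case: (i \in Y);
      case: (j \in Z); case: (j < i)%N; by rewrite /= ?mulrNN ?mulr1 ?mul1r.
  have Sr X Y Z : S X (symdiff Y Z) = S X Y * S X Z.
    rewrite /S -big_split; apply: eq_bigr => i _ /=.
    rewrite -big_split; apply: eq_bigr => j _ /=.
    rewrite /G in_symdiff; case: (i \in X); case: (j \in Y);
      case: (j \in Z); case: (j < i)%N; by rewrite /= ?mulrNN ?mulr1 ?mul1r.
  rewrite -/(S I J) -/(S (symdiff I J) K) -/(S I (symdiff J K)) -/(S J K).
  by rewrite Sl Sr mulrA subrr.
rewrite -!big_split; apply: eq_bigr => k _ /=; rewrite !in_symdiff.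
by case: (k \in I); case: (k \in J); case: (k \in K);
  rewrite /= ?mulr1 ?mul1r.
Qed.

Lemma blade_sign0l I : blade_sign finset.set0 I = 1.
Proof. by rewrite /blade_sign finset.set0I !big_set0 mulr1. Qed.

Lemma blade_sign0r I : blade_sign I finset.set0 = 1.
Proof.
rewrite /blade_sign finset.setI0 big_set0 mulr1 big1 // => i _.
by rewrite big1 // => j; rewrite inE.
Qed.

Lemma Cl_mulE A B K : Cl_mul A B K =
  \sum_I blade_sign I (symdiff I K) * (A I * B (symdiff I K)).
Proof.
rewrite ffunE; apply: eq_bigr => I _.
by under eq_bigl do rewrite symdiff_eq; rewrite big_pred1_eq.
Qed.

Lemma Cl_mulA : associative Cl_mul.
Proof.
move=> A B C; apply/ffunP => L; rewrite !Cl_mulE.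
under eq_bigr do rewrite Cl_mulE !mulr_sumr.
under [RHS]eq_bigr do rewrite Cl_mulE mulr_suml mulr_sumr.
rewrite [RHS]exchange_big /=; apply: eq_bigr => I _.
rewrite [RHS](reindex_inj (can_inj (symdiffK I))) /=; apply: eq_bigr => J _.
rewrite symdiffK.
have -> : symdiff (symdiff I J) L = symdiff J (symdiff I L).
  by rewrite symdiffA (symdiffC J).
set K := symdiff J (symdiff I L).
have -> : symdiff I L = symdiff J K by rewrite /K symdiffK.
have := blade_sign_cocycle I J K.
set s1 := blade_sign I J; set s2 := blade_sign _ K.
set s3 := blade_sign I _; set s4 := blade_sign J K => E.
rewrite (_ : _ * _ = (s3 * s4) * (A I * B J * C K)); last first.
  by rewrite [A I * _]mulrCA !mulrA.
by rewrite -E [in LHS](mulrC s1) -!mulrA.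
Qed.

Lemma Cl_mul1l : left_id Cl_one Cl_mul.
Proof.
move=> A; apply/ffunP => K; rewrite Cl_mulE (bigD1 finset.set0) //= big1.
  by rewrite symdiff0 blade_sign0l ffunE eqxx addr0 !mul1r.
by move=> I /negbTE I0; rewrite ffunE I0 mul0r mulr0.
Qed.

Lemma Cl_mul1r : right_id Cl_one Cl_mul.
Proof.
move=> A; apply/ffunP => K; rewrite Cl_mulE (bigD1 K) //= big1.
  by rewrite symdiffv blade_sign0r ffunE eqxx addr0 mulr1 mul1r.
move=> I /negbTE IK; rewrite ffunE symdiff_eq [symdiff I finset.set0]symdiffC.
by rewrite symdiff0 eq_sym IK !mulr0.
Qed.

Lemma Cl_mulDl : left_distributive Cl_mul +%R.
Proof.
move=> A B C; apply/ffunP => K; rewrite [RHS]ffunE !Cl_mulE -big_split.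
by apply: eq_bigr => I _; rewrite ffunE mulrDl mulrDr.
Qed.

Lemma Cl_mulDr : right_distributive Cl_mul +%R.
Proof.
move=> A B C; apply/ffunP => K; rewrite [RHS]ffunE !Cl_mulE -big_split.
by apply: eq_bigr => I _; rewrite ffunE !mulrDr.
Qed.

Lemma Cl_one_neq0 : Cl_one != 0.
Proof.
apply/eqP => /ffunP/(_ finset.set0)/eqP.
by rewrite !ffunE eqxx oner_eq0.
Qed.

HB.instance Definition _ := GRing.Zmodule_isNzRing.Build (Cl R p q)
  Cl_mulA Cl_mul1l Cl_mul1r Cl_mulDl Cl_mulDr Cl_one_neq0.

Lemma ClME A B K : (A * B) K =
  \sum_I blade_sign I (symdiff I K) * (A I * B (symdiff I K)).
Proof. exact: Cl_mulE. Qed.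

Definition Cl_scale (a : R) A : Cl R p q := [ffun K => a * A K].

Lemma Cl_scaleA (a b : R) A : Cl_scale a (Cl_scale b A) = Cl_scale (a * b) A.
Proof. by apply/ffunP => K; rewrite !ffunE mulrA. Qed.

Lemma Cl_scale1 : left_id 1 Cl_scale.
Proof. by move=> A; apply/ffunP => K; rewrite !ffunE mul1r. Qed.

Lemma Cl_scaleDr : right_distributive Cl_scale +%R.
Proof. by move=> a A B; apply/ffunP => K; rewrite !ffunE mulrDr. Qed.

Lemma Cl_scaleDl A : {morph Cl_scale^~ A : a b / a + b}.
Proof. by move=> a b; apply/ffunP => K; rewrite !ffunE mulrDl. Qed.

HB.instance Definition _ := GRing.Zmodule_isLmodule.Build R (Cl R p q)
  Cl_scaleA Cl_scale1 Cl_scaleDr Cl_scaleDl.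

Lemma ClZE (a : R) A K : (a *: A) K = a * A K.
Proof. exact: ffunE. Qed.

Lemma Cl_scalerAl (a : R) A B : a *: (A * B) = (a *: A) * B.
Proof.
apply/ffunP => K; rewrite ClZE !ClME mulr_sumr.
by apply: eq_bigr => I _; rewrite ClZE mulrCA -(mulrA a).
Qed.

HB.instance Definition _ :=
  GRing.Lmodule_isLalgebra.Build R (Cl R p q) Cl_scalerAl.

Lemma Cl_scalerAr (a : R) A B : a *: (A * B) = A * (a *: B).
Proof.
apply/ffunP => K; rewrite ClZE !ClME mulr_sumr.
apply: eq_bigr => I _; rewrite ClZE.
by rewrite mulrCA (mulrCA (A I)).
Qed.

HB.instance Definition _ :=
  GRing.Lalgebra_isAlgebra.Build R (Cl R p q) Cl_scalerAr.

Lemma Cl1E K : (1 : Cl R p q) K = (K == finset.set0)%:R.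
Proof. exact: ffunE. Qed.

Definition blade I : Cl R p q := [ffun K => (K == I)%:R].

Lemma blade_decomp A : A = \sum_I A I *: blade I.
Proof.
apply/ffunP => K; rewrite sum_ffunE (bigD1 K) //= ClZE ffunE eqxx mulr1.
by rewrite big1 ?addr0 // => I /negbTE IK; rewrite ClZE ffunE eq_sym IK mulr0.
Qed.

Lemma bladeM I J : blade I * blade J = blade_sign I J *: blade (symdiff I J).
Proof.
apply/ffunP => K; rewrite ClME ClZE (bigD1 I) //= big1 => [|I' /negbTE I'I].
  rewrite !ffunE eqxx mul1r addr0 symdiff_eq.
  by case: eqP => [->|_]; rewrite ?symdiffK // !mulr0.
by rewrite ffunE I'I mul0r mulr0.
Qed.

Definition gen (k : 'I_n) : Cl R p q := blade [set k]%SET.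

Lemma blade_sign1l (k : 'I_n) J : blade_sign [set k]%SET J =
  (\prod_(j in J | (j < k)%N) -1) * (if k \in J then signature k else 1).
Proof.
rewrite /blade_sign big_set1; congr (_ * _); case: ifPn => kJ.
  by rewrite (finset.setIidPl _) ?big_set1 // finset.sub1set.
rewrite big1 // => i; rewrite !inE => /andP[/eqP -> kJ'].
by rewrite kJ' in kJ.
Qed.

Lemma gen_relation (j k : 'I_n) :
  gen j * gen k + gen k * gen j = (2 * signature j * (j == k)%:R)%:A.
Proof.
rewrite !bladeM !blade_sign1l (symdiffC [set k]%SET) -scalerDl !inE.
have E (a b : 'I_n) : \prod_(i in [set a]%SET | (i < b)%N) (-1 : R)
    = if (a < b)%N then -1 else 1.
  rewrite big_mkcondr /=; under eq_bigl do rewrite inE.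
  by rewrite big_pred1_eq.
rewrite !E (eq_sym k); have [->|jk] := eqVneq j k.
  rewrite ltnn !mul1r mulr1 symdiffv mulr_natl mulr2n; congr (_ *: _).
rewrite !mulr1 mulr0 scale0r; case: ltngtP => [||/val_inj e]; last first.
- by rewrite e eqxx in jk.
- by rewrite subrr scale0r.
- by rewrite addNr scale0r.
Qed.

Lemma blade_prod_gen I : blade I = \prod_(k <- enum I) gen k.
Proof.
have key (s : seq 'I_n) : sorted (fun a b : 'I_n => a < b)%N s ->
    \prod_(k <- s) gen k = blade [set x in s]%SET.
  elim: s => [_|k s IHs ks].
    by rewrite big_nil; congr blade; apply/setP => x; rewrite !inE.
  rewrite big_cons IHs ?(path_sorted ks) // bladeM blade_sign1l.
  have kP x : x \in s -> (k < x)%N.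
    have tr : transitive (fun a b : 'I_n => a < b)%N.
      by move=> ? ? ?; exact: ltn_trans.
    by move/(allP (order_path_min tr ks)).
  have kNs : k \notin s by apply/negP => /kP; rewrite ltnn.
  rewrite inE (negbTE kNs) mulr1 big1 ?scale1r => [|x]; last first.
    by rewrite inE => /andP[/kP kx xk]; have := ltn_trans kx xk; rewrite ltnn.
  congr blade; apply/setP => x; rewrite in_symdiff !inE.
  by have [->|//] := eqVneq x k; rewrite (negbTE kNs).
rewrite key; first by congr blade; apply/setP => x; rewrite inE mem_enum.
rewrite /(enum _) sorted_filter //; first by move=> ? ? ?; exact: ltn_trans.
have : sorted ltn (map val (Finite.enum 'I_n)).
  by rewrite -enumT val_enum_ord iota_ltn_sorted.
by rewrite sorted_map.
Qed.

End CliffordAlgebra.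

Section LebesgueMeasure.
Local Open Scope classical_set_scope.
Local Open Scope ereal_scope.
Variable R : realType.
Local Notation RR := (measurableTypeR R).

Definition tuple_cons m (z : RR * m.-tuple RR) : m.+1.-tuple RR :=
  [tuple of z.1 :: z.2].

Lemma measurable_tuple_cons m : measurable_fun setT (@tuple_cons m).
Proof. exact: measurable_cons. Qed.

Definition lebesgue_cons m (mu : {sigma_finite_measure set (m.-tuple RR) -> \bar R})
    : set (m.+1.-tuple RR) -> \bar R :=
  pushforward (@lebesgue_measure R \x mu) (@tuple_cons m).

Section lebesgue_cons.
Variables (m : nat) (mu : {sigma_finite_measure set (m.-tuple RR) -> \bar R}).

HB.instance Definition _ := Measure.copy (lebesgue_cons mu)
  (measure_function_pushforward__canonical__measure_function_Measure
     (@lebesgue_measure R \x mu) (@measurable_tuple_cons m)).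

Lemma lebesgue_cons_sigma_finite : sigma_finite setT (lebesgue_cons mu).
Proof.
have /sigma_finiteP[F [TF ndF Foo]] := sigma_finiteT (@lebesgue_measure R).
have /sigma_finiteP[G [TG ndG Goo]] := sigma_finiteT mu.
pose uncons (t : m.+1.-tuple RR) : RR * m.-tuple RR :=
  (thead t, [tuple of behead t]).
have muncons : measurable_fun setT uncons.
  apply/measurable_fun_pairP; split; first exact: measurable_tnth.
  exact: measurable_behead.
have consK : cancel (@tuple_cons m) uncons.
  by move=> [x t]; congr (_, _); exact: val_inj.
exists (fun k => uncons @^-1` (F k `*` G k)).
  apply/seteqP; split => // t _.
  have [i _ Fi] : (\bigcup_i F i) (thead t) by rewrite -TF.
  have [j _ Gj] : (\bigcup_i G i) [tuple of behead t] by rewrite -TG.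
  exists (maxn i j) => //; split => /=.
    by move: Fi; apply/subsetPset/ndF/leq_maxl.
  by move: Gj; apply/subsetPset/ndG/leq_maxr.
move=> k; have [mF Fk] := Foo k; have [mG Gk] := Goo k; split.
  by rewrite -[X in measurable X]setTI; apply: muncons => //; exact: measurableX.
rewrite /lebesgue_cons /pushforward -comp_preimage.
rewrite (_ : uncons \o _ = id) ?preimage_id; last exact/funext/consK.
by rewrite product_measure1E// lte_mul_pinfty// ge0_fin_numE.
Qed.

HB.instance Definition _ := Measure_isSigmaFinite.Build _ _ _
  (lebesgue_cons mu) lebesgue_cons_sigma_finite.

End lebesgue_cons.

(* borel_lebesgue is the m-fold product measure on the Borel sets of R^m;
   lebesgue is its completion. *)
Fixpoint borel_lebesgue m : {sigma_finite_measure set (m.-tuple RR) -> \bar R} :=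
  if m is m'.+1 then lebesgue_cons (borel_lebesgue m') else \d_ [tuple].

Definition lebesgue m := @completed_measure_extension _ _ R (borel_lebesgue m).

Arguments lebesgue : clear implicits.

HB.instance Definition _ m := Measure.on (lebesgue m).

End LebesgueMeasure.

Arguments lebesgue : clear implicits.

Section GeometricFourierTransform.
Local Open Scope classical_set_scope.
Variables (R : realType) (m p q : nat).
Local Notation Rm := (m.-tuple R).
Local Notation Cl := (Cl R p q).
Implicit Types (F : seq (Rm -> Rm -> Cl)) (A B C D E : Cl).

(* Convergence in the finite-dimensional space Cl_{p,q} is convergence of
   all blade coordinates. *)
Definition Cl_exp A : Cl :=
  [ffun I => limn (series (fun j => (j`!%:R^-1 *: A ^+ j) I))].

Definition neg_sqrt : set Cl :=
  [set i | i = 0 \/ exists2 r : R, r < 0 & i ^+ 2 = r%:A].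

Definition gft_integrand F1 F2 (B : Rm -> Cl) (u x : Rm) : Cl :=
  (\prod_(f <- F1) Cl_exp (- f x u)) * B x * \prod_(f <- F2) Cl_exp (- f x u).

(* Integrals of multivector fields are taken coordinatewise. *)
Definition gft_exists F1 F2 (B : Rm -> Cl) (u : Rm) : Prop :=
  forall I, (lebesgue R m).-integrable setT
    (fun x => (gft_integrand F1 F2 B u x I)%:E).

Definition gft F1 F2 (B : Rm -> Cl) (u : Rm) : Cl :=
  [ffun I => \int[lebesgue R m]_x gft_integrand F1 F2 B u x I].

Definition left_linear F1 F2 : Prop :=
  forall C D (B E : Rm -> Cl) u,
    gft_exists F1 F2 B u -> gft_exists F1 F2 E u ->
    gft F1 F2 (fun x => C * B x + D * E x) u
    = C * gft F1 F2 B u + D * gft F1 F2 E u.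

Definition right_linear F1 F2 : Prop :=
  forall C D (B E : Rm -> Cl) u,
    gft_exists F1 F2 B u -> gft_exists F1 F2 E u ->
    gft F1 F2 (fun x => B x * C + E x * D) u
    = gft F1 F2 B u * C + gft F1 F2 E u * D.

End GeometricFourierTransform.

(* Main.v *)
Require Import Defs.
From mathcomp Require Import all_boot all_order all_algebra.
From mathcomp Require Import all_classical all_reals all_analysis.

Local Open Scope ring_scope.

Import Order.TTheory GRing.Theory Num.Theory.
Import numFieldNormedType.Exports.

(** The integrand of the transform is P(x) A(x) Q(x), where P and Q are the
    products of the exponentials of the -f(x, u) for f in F1 and in F2. If the
    values of F1 are central, then so is P(x), and a constant factor C on the
    left of A(x) can be moved in front of the integrand:
    P(x) (C A(x)) Q(x) = C (P(x) A(x) Q(x)). It then leaves the integral,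
    because an integral taken coordinatewise commutes with every linear
    endomorphism of the finite-dimensional space Cl R p q. The right-hand case
    is symmetric, with Q(x) in place of P(x).

    The analytic point is that the exponential of a central element is
    central. The exponential is defined coordinate by coordinate, through
    limits, so its series must be known to converge before multiplication by a
    constant can be exchanged with the limit. Convergence holds for every
    multivector ([Cl_exp_cvg]): the sum of the absolute values of the
    coordinates is a submultiplicative norm ([Cl_norm1M]), so the series is
    dominated by a real exponential series. Multiplication by a constant, being
    linear, is then compatible with the limit ([linear_coord_cvg]), and an
    element that commutes with Z, hence with every partial sum, commutes with
    the exponential of Z ([commr_Cl_exp]). *)

(** Limits and integrals of multivectors are coordinatewise; this formula,
    with coefficients independent of [A], is what lets linear maps be exchanged
    with them. *)
Lemma linear_coordE (R : realType) (p q : nat)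
    (L : {linear Cl R p q -> Cl R p q}) (A : Cl R p q) (K : {set 'I_(p + q)}) :
  L A K = \sum_I L (blade R I) K * A I.
Proof.
rewrite {1}(blade_decomp A) linear_sum sum_ffunE.
by apply: eq_bigr => I _; rewrite linearZ /= ClZE mulrC.
Qed.

Lemma cvg_linear_combination (R : realType) (I : Type) (s : seq I) (c l : I -> R)
    (u : I -> nat -> R) :
  (forall i, u i n @[n --> \oo] --> l i)%classic ->
  (\sum_(i <- s) c i * u i n @[n --> \oo] --> \sum_(i <- s) c i * l i)%classic.
Proof.
move=> ul; elim: s => [|i s IHs].
  by under eq_fun do rewrite big_nil; rewrite big_nil; exact: cvg_cst.
under eq_fun do rewrite big_cons; rewrite big_cons.
by apply: cvgD => //; apply: cvgM => //; exact: cvg_cst.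
Qed.

Lemma linear_coord_cvg (R : realType) (p q : nat)
    (L : {linear Cl R p q -> Cl R p q}) (S : nat -> Cl R p q) (A : Cl R p q)
    (K : {set 'I_(p + q)}) :
  (forall I, S n I @[n --> \oo] --> A I)%classic ->
  (L (S n) K @[n --> \oo] --> L A K)%classic.
Proof.
move=> SA; rewrite linear_coordE; under eq_fun do rewrite linear_coordE.
exact: cvg_linear_combination.
Qed.

Definition Cl_norm1 (R : realType) (p q : nat) (A : Cl R p q) : R :=
  \sum_I `|A I|.

Lemma coord_le_Cl_norm1 (R : realType) (p q : nat) (A : Cl R p q)
    (I : {set 'I_(p + q)}) :
  `|A I| <= Cl_norm1 R p q A.
Proof. by rewrite /Cl_norm1 (bigD1 I) //= lerDl sumr_ge0. Qed.

Lemma normr_blade_sign (R : realType) (p q : nat) (I J : {set 'I_(p + q)}) :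
  `|blade_sign R I J| = 1.
Proof.
rewrite normrM !normr_prod big1 ?mul1r => [|i _].
  rewrite big1 // => k _; rewrite /signature.
  by case: ifP; rewrite ?normrN normr1.
by rewrite normr_prod big1 // => j _; rewrite normrN normr1.
Qed.

(** A product of two blades is plus or minus a blade, so each |A I| |B J|
    enters the bound for exactly one coordinate of the product. *)
Lemma Cl_norm1M (R : realType) (p q : nat) (A B : Cl R p q) :
  Cl_norm1 R p q (A * B) <= Cl_norm1 R p q A * Cl_norm1 R p q B.
Proof.
rewrite /Cl_norm1 mulr_suml.
apply: (@le_trans _ _ (\sum_K \sum_I `|A I| * `|B (symdiff I K)|)).
  apply: ler_sum => K _; rewrite ClME; apply: le_trans (ler_norm_sum _ _ _) _.
  by apply: ler_sum => I _; rewrite normrM normr_blade_sign mul1r normrM.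
rewrite exchange_big /=; apply: ler_sum => I _.
by rewrite -mulr_sumr [in leRHS](reindex_inj (can_inj (symdiffK I))).
Qed.

Lemma Cl_norm1X (R : realType) (p q : nat) (A : Cl R p q) (j : nat) :
  Cl_norm1 R p q (A ^+ j) <= Cl_norm1 R p q A ^+ j.
Proof.
have N_ge0 B : 0 <= Cl_norm1 R p q B by exact: sumr_ge0.
elim: j => [|j IHj].
  rewrite !expr0 /Cl_norm1 (bigD1 finset.set0) //= big1 => [|I /negbTE I0].
    by rewrite Cl1E eqxx normr1 addr0.
  by rewrite Cl1E I0 normr0.
rewrite !exprS; apply: le_trans (Cl_norm1M _ _ _ _ _) _.
exact: ler_wpM2l.
Qed.

Lemma Cl_exp_cvg (R : realType) (p q : nat) (Z : Cl R p q)
    (I : {set 'I_(p + q)}) :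
  ((\sum_(0 <= j < n) j`!%:R^-1 *: Z ^+ j : Cl R p q) I @[n --> \oo]
     --> Cl_exp Z I)%classic.
Proof.
under eq_fun do rewrite sum_ffunE.
rewrite /Cl_exp ffunE.
suff : cvgn (series (fun j => (j`!%:R^-1 *: Z ^+ j : Cl R p q) I)) by [].
apply: normed_cvg.
apply: series_le_cvg (is_cvg_series_exp_coeff (Cl_norm1 R p q Z)) => n //=.
  by rewrite /exp_coeff /= divr_ge0 ?ler0n ?exprn_ge0 ?sumr_ge0.
rewrite /exp_coeff /= ClZE normrM normfV normr_nat mulrC ler_wpM2r ?invr_ge0 //.
exact: le_trans (coord_le_Cl_norm1 _ _ _ _ _) (Cl_norm1X _ _ _ _ _).
Qed.

Lemma commr_Cl_exp (R : realType) (p q : nat) (A Z : Cl R p q) :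
  GRing.comm A Z -> GRing.comm A (Cl_exp Z).
Proof.
move=> AZ; apply/ffunP => K.
pose S n : Cl R p q := \sum_(0 <= j < n) j`!%:R^-1 *: Z ^+ j.
have AS n : A * S n = S n * A.
  apply: commr_sum => j _; rewrite /GRing.comm -scalerAr -scalerAl.
  by congr (_ *: _); exact: commrX.
have lim_l := linear_coord_cvg R p q (A \*o (idfun : Cl R p q -> Cl R p q))
  S (Cl_exp Z) K (Cl_exp_cvg R p q Z).
have lim_r := linear_coord_cvg R p q (A \o* idfun) S (Cl_exp Z) K
  (Cl_exp_cvg R p q Z).
apply: (cvg_unique _ lim_l) => //=.
by under eq_fun do rewrite AS.
Qed.

Section Integration.
Local Open Scope classical_set_scope.

Lemma Rintegral_linear_combination {d : measure_display} {T : measurableType d}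
    {R : realType} (mu : {measure set T -> \bar R}) (I : Type) (s : seq I)
    (c : I -> R) (g : I -> T -> R) :
  (forall i, mu.-integrable setT (EFin \o g i)) ->
  mu.-integrable setT (EFin \o (fun x => \sum_(i <- s) c i * g i x)) /\
  \int[mu]_x (\sum_(i <- s) c i * g i x)
  = \sum_(i <- s) c i * \int[mu]_x g i x.
Proof.
move=> gint; elim: s => [|i s [IHint IHs]].
  have -> : (fun x => \sum_(i <- [::]) c i * g i x) = cst 0.
    by apply/funext => x; rewrite big_nil.
  split; first exact: integrable0.
  by rewrite big_nil /Rintegral integral0.
have -> : (fun x => \sum_(j <- i :: s) c j * g j x)
    = (fun x => c i * g i x + \sum_(j <- s) c j * g j x).
  by apply/funext => x; rewrite big_cons.
have cgint : mu.-integrable setT (EFin \o (fun x => c i * g i x)).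
  exact: (integrableZl measurableT (c i) (gint i)).
split; first exact: (integrableD measurableT cgint IHint).
by rewrite big_cons RintegralD // RintegralZl // IHs.
Qed.

Lemma Rintegral_linear_coord {d : measure_display} {T : measurableType d}
    {R : realType} (mu : {measure set T -> \bar R}) (p q : nat)
    (L : {linear Cl R p q -> Cl R p q}) (G : T -> Cl R p q)
    (K : {set 'I_(p + q)}) :
  (forall I, mu.-integrable setT (EFin \o (fun x => G x I))) ->
  mu.-integrable setT (EFin \o (fun x => L (G x) K)) /\
  \int[mu]_x L (G x) K = L [ffun I => \int[mu]_x G x I] K.
Proof.
move=> Gint; rewrite [RHS]linear_coordE.
have -> : (fun x => L (G x) K) = (fun x => \sum_I L (blade R I) K * G x I).
  by apply/funext => x; rewrite linear_coordE.
have [? ->] := Rintegral_linear_combination mu _ (index_enum _)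
  (fun I => L (blade R I) K) (fun I x => G x I) Gint.
by split=> //; apply: eq_bigr => I _; rewrite ffunE.
Qed.

End Integration.

(** Left and right linearity are the cases where [L] and [M] are
    multiplications by constants. *)
Lemma gft_linear (R : realType) (m p q : nat)
    (F1 F2 : seq (m.-tuple R -> m.-tuple R -> Cl R p q))
    (L M : {linear Cl R p q -> Cl R p q}) (B E H : m.-tuple R -> Cl R p q)
    (u : m.-tuple R) :
  gft_exists F1 F2 B u -> gft_exists F1 F2 E u ->
  (forall x, gft_integrand F1 F2 H u x
     = L (gft_integrand F1 F2 B u x) + M (gft_integrand F1 F2 E u x)) ->
  gft F1 F2 H u = L (gft F1 F2 B u) + M (gft F1 F2 E u).
Proof.
move=> Bint Eint HBE; apply/ffunP => K; rewrite [LHS]ffunE [RHS]ffunE.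
have [LB <-] := Rintegral_linear_coord (lebesgue R m) p q L
  (gft_integrand F1 F2 B u) K Bint.
have [ME <-] := Rintegral_linear_coord (lebesgue R m) p q M
  (gft_integrand F1 F2 E u) K Eint.
rewrite -RintegralD //; congr Rintegral; apply/funext => x.
by rewrite HBE ffunE.
Qed.

Lemma commr_exp_factors (R : realType) (m p q : nat)
    (F : seq (m.-tuple R -> m.-tuple R -> Cl R p q)) (x u : m.-tuple R)
    (A : Cl R p q) :
  (forall f, f \in F -> A * f x u = f x u * A) ->
  GRing.comm A (\prod_(f <- F) Cl_exp (- f x u)).
Proof.
move=> AF; rewrite big_seq; apply: commr_prod => f fF.
by apply/commr_Cl_exp/commrN/AF.
Qed.

Theorem corollary6p7 (R : realType) (m p q : nat)
    (F1 F2 : seq (m.-tuple R -> m.-tuple R -> Cl R p q))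
    (hF1 : forall f, f \in F1 -> forall x u, neg_sqrt (f x u))
    (hF2 : forall f, f \in F2 -> forall x u, neg_sqrt (f x u)) :
  ((forall f, f \in F1 ->
      forall (x u : m.-tuple R) (A : Cl R p q), A * f x u = f x u * A) ->
    left_linear F1 F2)
  /\
  ((forall f, f \in F2 ->
      forall (x u : m.-tuple R) (A : Cl R p q), A * f x u = f x u * A) ->
    right_linear F1 F2).
Proof.
split=> central C D B E u Bint Eint.
  apply: (gft_linear _ _ _ _ _ _ (C \*o (idfun : Cl R p q -> Cl R p q))
    (D \*o (idfun : Cl R p q -> Cl R p q)) B E) => // x /=.
  rewrite /gft_integrand mulrDr mulrDl !mulrA.
  by rewrite !(commr_exp_factors _ _ _ _ F1) // => f fF; exact: central.
apply: (gft_linear _ _ _ _ _ _ (C \o* idfun) (D \o* idfun) B E) => // x /=.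
rewrite /gft_integrand mulrDr mulrDl -!mulrA.
by rewrite !(commr_exp_factors _ _ _ _ F2) // => f fF; exact: central.
Qed.
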